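(* For every $k\in\mathbb N$, the automorphism $\sigma$ of $\mathcal O$ sends $$\mathcal W_{-k}\mapsto\mathcal W_{k+1},\qquad \mathcal W_{k+1}\mapsto\mathcal W_{-k},\qquad \tilde{\mathcal G}_{k+1}\mapsto\mathcal G_{k+1},\qquad \mathcal G_{k+1}\mapsto\tilde{\mathcal G}_{k+1},$$ and the antiautomorphism $\dagger$ of $\mathcal O$ sends $$\mathcal W_{-k}\mapsto\mathcal W_{-k},\qquad \mathcal W_{k+1}\mapsto\mathcal W_{k+1},\qquad \tilde{\mathcal G}_{k+1}\mapsto\mathcal G_{k+1},\qquad \mathcal G_{k+1}\mapsto\tilde{\mathcal G}_{k+1}.$$
   Context: $\mathbb F$ is a field of characteristic zero; all vector spaces and Lie algebras are over $\mathbb F$. $\mathbb N=\{0,1,2,\ldots\}$. $\mathbb F[t,t^{-1}]$ is the algebra of Laurent polynomials. $L(\mathfrak{gl}_2)=\mathfrak{gl}_2\otimes\mathbb F[t,t^{-1}]$ is the loop algebra, with Lie bracket $[u\otimes\varphi,v\otimes\phi]=[u,v]\otimes\varphi\phi$; its elements are viewed as $2\times 2$ matrices with entries in $\mathbb F[t,t^{-1}]$, with bracket $[x,y]=xy-yx$. For $x=\begin{pmatrix} a(t)&b(t)\\ c(t)&d(t)\end{pmatrix}\in L(\mathfrak{gl}_2)$ define $$\theta(x)=\begin{pmatrix} d(t^{-1})&c(t^{-1})\\ b(t^{-1})&a(t^{-1})\end{pmatrix},\quad \sigma(x)=\begin{pmatrix} d(t)&c(t)t\\ b(t)t^{-1}&a(t)\end{pmatrix},\quad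 \dagger(x)=\begin{pmatrix} a(t^{-1})&c(t^{-1})\\ b(t^{-1})&d(t^{-1})\end{pmatrix},$$ and $\varepsilon(x)=a(1)+d(1)\in\mathbb F$. An antiautomorphism of a Lie algebra $\mathfrak g$ is a vector space isomorphism $\alpha:\mathfrak g\to\mathfrak g$ with $\alpha([u,v])=[\alpha(v),\alpha(u)]$ for all $u,v$. The maps $\theta,\sigma$ are automorphisms and $\dagger$ is an antiautomorphism of $L(\mathfrak{gl}_2)$; they mutually commute, and $\varepsilon:L(\mathfrak{gl}_2)\to\mathbb F$ is a Lie algebra homomorphism ($\mathbb F$ abelian). Let $\mathcal L=\ker\varepsilon$, and let $\mathcal O$ be the Lie algebra of all elements of $\mathcal L$ fixed by $\theta$. $\mathcal O$ is invariant under $\sigma$ and $\dagger$, and the restrictions of $\sigma,\dagger$ to $\mathcal O$ are again denoted $\sigma,\dagger$. For $k\in\mathbb N$ define \begin{align*} &\mathcal W_{-k}=\Bigl(\tfrac{t+t^{-1}}{2}\Bigr)^k\begin{pmatrix}0&1\\1&0\end{pmatrix},\qquad \mathcal W_{k+1}=\Bigl(\tfrac{t+t^{-1}}{2}\Bigr)^k\begin{pmatrix}0&t\\t^{-1}&0\end{pmatrix},\\ &\mathcal G_{k+1}=\Bigl(\tfrac{t+t^{-1}}{2}\Bigr)^k\begin{pmatrix}2t-2&0\\0&2t^{-1}-2\end{pmatrix},\qquad \tilde{\mathcal G}_{k+1}=\Bigl(\tfrac{t+t^{-1}}{2}\Bigr)^k\begin{pmatrix}2t^{-1}-2&0\\0&2t-2\end{pmatrix}.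 \end{align*} *)

(* Defs.v *)
From HB Require Import structures.
From mathcomp Require Import all_boot all_order all_algebra.
From mathcomp Require Import finmap.
From mathcomp Require Import multinomials.monalg.
From mathcomp Require Import ring.

Set Implicit Arguments.
Unset Strict Implicit.
Unset Printing Implicit Defensive.

Import GRing.Theory.
Local Open Scope fset_scope.
Local Open Scope ring_scope.

(* F[t, t^-1]: finitely supported families of coefficients indexed by the
   exponents in int.  The multinomials library multiplies {malg F[K]} only for a
   monomial type K, in which 1 is the only unit; this excludes int, so the
   convolution product is defined here. *)
Definition laurent (F : fieldType) : Type := {malg F[int]}.

HB.instance Definition _ (F : fieldType) :=
  GRing.Lmodule.copy (laurent F) {malg F[int]}.

Section LaurentRing.
Variable F : fieldType.
Implicit Types (p q r : laurent F) (c d : F) (i j k : int).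

Definition lmono c k : laurent F := << c *g k >>.

Definition lmul p q : laurent F :=
  \sum_(i <- msupp p) \sum_(j <- msupp q) lmono (p@_i * q@_j) (i + j).

Lemma lmono0 k : lmono 0 k = 0. Proof. exact: monalgU0. Qed.
Lemma lmonoD k : {morph lmono^~ k : c d / c + d}.
Proof. exact: monalgUD. Qed.

Lemma lsumw (V : zmodType) (phi : int -> F -> V) (d : {fset int}) p :
    (forall k, phi k 0 = 0) -> msupp p `<=` d ->
  \sum_(k <- msupp p) phi k p@_k = \sum_(k <- d) phi k p@_k.
Proof.
move=> phi0 le; apply: (big_fset_incl _ le) => k _ /mcoeff_outdom ->.
exact: phi0.
Qed.

Lemma lsumD (V : zmodType) (phi : int -> F -> V) p q :
    (forall k, {morph phi k : c d / c + d}) ->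
  \sum_(k <- msupp (p + q)) phi k (p + q)@_k =
  \sum_(k <- msupp p) phi k p@_k + \sum_(k <- msupp q) phi k q@_k.
Proof.
move=> phiD; have phi0 k : phi k 0 = 0.
  by apply: (addrI (phi k 0)); rewrite -phiD !addr0.
rewrite (@lsumw _ _ (msupp p `|` msupp q) (p + q)) ?msuppD_le //.
rewrite (@lsumw _ _ (msupp p `|` msupp q) p) ?fsubsetUl //.
rewrite (@lsumw _ _ (msupp p `|` msupp q) q) ?fsubsetUr // -big_split /=.
by apply: eq_bigr => k _; rewrite mcoeffD phiD.
Qed.

Lemma lsumU (V : zmodType) (phi : int -> F -> V) c k : phi k 0 = 0 ->
  \sum_(i <- msupp (lmono c k)) phi i (lmono c k)@_i = phi k c.
Proof.
move=> phi0; rewrite msuppU; case: eqP => [->|_].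
  by rewrite big_seq_fset0 phi0.
by rewrite big_seq_fset1 mcoeffUU.
Qed.

Lemma laurentE p : p = \sum_(k <- msupp p) lmono p@_k k.
Proof. exact: monalgE. Qed.

Lemma laurent_ind (P : laurent F -> Prop) :
    P 0 -> (forall c k, P (lmono c k)) -> (forall p q, P p -> P q -> P (p + q)) ->
  forall p, P p.
Proof. by move=> P0 P1 PD p; rewrite (laurentE p); apply: big_ind. Qed.

Lemma lmulDl : left_distributive lmul +%R.
Proof.
move=> p q r.
apply: (lsumD (phi := fun i c => \sum_(j <- msupp r) lmono (c * r@_j) (i + j))).
move=> i c d; rewrite -big_split; apply: eq_bigr => j _.
by rewrite mulrDl lmonoD.
Qed.

Lemma lmulC : commutative lmul.
Proof.
move=> p q; rewrite /lmul exchange_big; apply: eq_bigr => j _.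
by apply: eq_bigr => i _; rewrite mulrC addrC.
Qed.

Lemma lmulDr : right_distributive lmul +%R.
Proof. by move=> p q r; rewrite lmulC lmulDl !(lmulC p). Qed.

Lemma lmul0p : left_zero 0 lmul.
Proof. by move=> p; rewrite /lmul msupp0 big_seq_fset0. Qed.

Lemma lmulp0 : right_zero 0 lmul.
Proof. by move=> p; rewrite lmulC lmul0p. Qed.

Lemma lmulUU c d i j : lmul (lmono c i) (lmono d j) = lmono (c * d) (i + j).
Proof.
rewrite /lmul.
rewrite (lsumU (phi := fun i c =>
  \sum_(k <- msupp (lmono d j)) lmono (c * (lmono d j)@_k) (i + k))).
  rewrite (lsumU (phi := fun k e => lmono (c * e) (i + k))) //.
  by rewrite mulr0 lmono0.
by apply: big1 => k _; rewrite mul0r lmono0.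
Qed.

Lemma lmulA : associative lmul.
Proof.
move=> p q r; elim/laurent_ind: p => [|c i|p p' IHp IHp'].
- by rewrite !lmul0p.
- elim/laurent_ind: q => [|d j|q q' IHq IHq'].
  + by rewrite !(lmul0p, lmulp0).
  + elim/laurent_ind: r => [|e k|r r' IHr IHr'].
    * by rewrite !lmulp0.
    * by rewrite !lmulUU mulrA addrA.
    * by rewrite !lmulDr IHr IHr'.
  + by rewrite !(lmulDl, lmulDr) IHq IHq'.
- by rewrite !lmulDl IHp IHp'.
Qed.

Lemma lmul1p : left_id (lmono 1 0) lmul.
Proof.
elim/laurent_ind => [|c k|p q IHp IHq]; first exact: lmulp0.
  by rewrite lmulUU mul1r add0r.
by rewrite lmulDr IHp IHq.
Qed.

Lemma lone_neq0 : lmono 1 0 != 0.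
Proof. by rewrite monalgU_eq0 oner_eq0. Qed.

HB.instance Definition _ := GRing.Zmodule_isComNzRing.Build (laurent F)
  lmulA lmulC lmul1p lmulDl lone_neq0.

Lemma lscaleU c d k : c *: lmono d k = lmono (c * d) k.
Proof. by apply/malgP => i; rewrite mcoeffZ !mcoeffU mulrnAr. Qed.

Lemma lscaleAl c p q : c *: (p * q) = (c *: p) * q.
Proof.
have scaleE r : c *: r = lmul (lmono c 0) r.
  elim/laurent_ind: r => [|d k|r r' IHr IHr'].
  - by rewrite lmulp0 scaler0.
  - by rewrite lmulUU lscaleU add0r.
  - by rewrite lmulDr scalerDr IHr IHr'.
by rewrite !scaleE; apply: lmulA.
Qed.

HB.instance Definition _ :=
  GRing.Lmodule_isLalgebra.Build F (laurent F) lscaleAl.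
HB.instance Definition _ := GRing.Lalgebra_isComAlgebra.Build F (laurent F).

Lemma lmonoM c d i j : lmono c i * lmono d j = lmono (c * d) (i + j).
Proof. exact: lmulUU. Qed.

Lemma lmono1 : lmono 1 0 = 1. Proof. by []. Qed.

(* The indeterminate t and its inverse. *)
Definition tvar : laurent F := lmono 1 1.
Definition tinv : laurent F := lmono 1 (-1).

Lemma tvarK : tvar * tinv = 1. Proof. by rewrite lmonoM mulr1 subrr. Qed.

(* p(t^-1) *)
Definition linv p : laurent F := \sum_(k <- msupp p) lmono p@_k (- k).

(* p(x); meant for x != 0, since exponents may be negative. *)
Definition leval (x : F) p : F := \sum_(k <- msupp p) p@_k * x ^ k.

Lemma linvU c k : linv (lmono c k) = lmono c (- k).
Proof. by rewrite /linv (lsumU (phi := fun k c => lmono c (- k))) ?lmono0. Qed.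

Lemma linvD : {morph linv : p q / p + q}.
Proof.
by move=> p q; apply: (lsumD (phi := fun k c => lmono c (- k))) => k;
  apply: lmonoD.
Qed.

Lemma linv_zmod : zmod_morphism linv.
Proof.
move=> p q; apply: (addIr (linv q)).
by rewrite -linvD !subrK.
Qed.

HB.instance Definition _ :=
  GRing.isZmodMorphism.Build (laurent F) (laurent F) linv linv_zmod.

Lemma linv_monoid : monoid_morphism linv.
Proof.
split; first by rewrite -lmono1 linvU oppr0.
move=> p q; elim/laurent_ind: p => [|c i|p p' IHp IHp'].
- by rewrite mul0r raddf0 mul0r.
- elim/laurent_ind: q => [|d j|q q' IHq IHq'].
  + by rewrite mulr0 raddf0 mulr0.
  + by rewrite !(linvU, lmonoM) opprD.
  + by rewrite !(linvD, mulrDr) IHq IHq'.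
- by rewrite !(linvD, mulrDl) IHp IHp'.
Qed.

HB.instance Definition _ :=
  GRing.isMonoidMorphism.Build (laurent F) (laurent F) linv linv_monoid.

Lemma linvM : {morph linv : p q / p * q}. Proof. exact: rmorphM. Qed.

Lemma linv_scalable : scalable linv.
Proof.
move=> c p; elim/laurent_ind: p => [|d k|p q IHp IHq].
- by rewrite scaler0 !raddf0.
- by rewrite !(lscaleU, linvU).
- by rewrite scalerDr !linvD IHp IHq scalerDr.
Qed.

HB.instance Definition _ :=
  GRing.isScalable.Build F (laurent F) (laurent F) *:%R linv linv_scalable.

Lemma linvK : involutive linv.
Proof.
elim/laurent_ind => [|c k|p q IHp IHq]; first by rewrite !raddf0.
  by rewrite !linvU opprK.
by rewrite !linvD IHp IHq.
Qed.

Lemma linv_tvar : linv tvar = tinv. Proof. exact: linvU. Qed.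
Lemma linv_tinv : linv tinv = tvar. Proof. by rewrite linvU opprK. Qed.

Lemma levalU x c k : leval x (lmono c k) = c * x ^ k.
Proof. by rewrite /leval (lsumU (phi := fun k c => c * x ^ k)) ?mul0r. Qed.

Lemma levalD x : {morph leval x : p q / p + q}.
Proof.
by move=> p q; apply: (lsumD (phi := fun k c => c * x ^ k)) => k c d;
  rewrite mulrDl.
Qed.

Lemma leval_zmod x : zmod_morphism (leval x).
Proof.
move=> p q; apply: (addIr (leval x q)).
by rewrite -levalD !subrK.
Qed.

HB.instance Definition _ x :=
  GRing.isZmodMorphism.Build (laurent F) F (leval x) (leval_zmod x).

Lemma leval_scalable x : scalable_for *%R (leval x).
Proof.
move=> c p; elim/laurent_ind: p => [|d k|p q IHp IHq].
- by rewrite scaler0 raddf0 mulr0.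
- by rewrite lscaleU !levalU mulrA.
- by rewrite scalerDr !levalD IHp IHq mulrDr.
Qed.

HB.instance Definition _ x :=
  GRing.isScalable.Build F (laurent F) F *%R (leval x) (leval_scalable x).

Lemma levalM x : x != 0 -> {morph leval x : p q / p * q}.
Proof.
move=> x0 p q; elim/laurent_ind: p => [|c i|p p' IHp IHp'].
- by rewrite mul0r raddf0 mul0r.
- elim/laurent_ind: q => [|d j|q q' IHq IHq'].
  + by rewrite mulr0 raddf0 mulr0.
  + by rewrite lmonoM !levalU expfzDr // mulrACA.
  + by rewrite !(mulrDr, levalD) IHq IHq'.
- by rewrite !(mulrDl, levalD) IHp IHp'.
Qed.

Lemma leval_linv p : leval 1 (linv p) = leval 1 p.
Proof.
elim/laurent_ind: p => [|c k|p q IHp IHq]; first by rewrite !raddf0.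
  by rewrite linvU !levalU !exp1rz.
by rewrite linvD !levalD IHp IHq.
Qed.

End LaurentRing.

HB.mixin Record Lmodule_isLieAlgebra (F : fieldType) L of GRing.Lmodule F L := {
  bracket : L -> L -> L;
  bracket_linearl : forall y, linear (bracket^~ y);
  bracket_linearr : forall x, linear (bracket x);
  bracketxx : forall x, bracket x x = 0;
  bracket_jacobi : forall x y z,
    bracket x (bracket y z) + bracket y (bracket z x) + bracket z (bracket x y)
    = 0
}.

#[short(type="lieAlgType")]
HB.structure Definition LieAlgebra (F : fieldType) :=
  { L of GRing.Lmodule F L & Lmodule_isLieAlgebra F L }.

Notation "[ 'lie' x , y ]" := (bracket x y)
  (at level 0, format "[ 'lie'  x ,  y ]") : ring_scope.

Record lie_aut (F : fieldType) (L : lieAlgType F) := LieAut {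
  lie_aut_fun :> L -> L;
  lie_aut_linear : linear lie_aut_fun;
  lie_aut_bij : bijective lie_aut_fun;
  lie_aut_bracket : forall u v,
    lie_aut_fun [lie u, v] = [lie lie_aut_fun u, lie_aut_fun v]
}.

Record lie_antiaut (F : fieldType) (L : lieAlgType F) := LieAntiaut {
  lie_antiaut_fun :> L -> L;
  lie_antiaut_linear : linear lie_antiaut_fun;
  lie_antiaut_bij : bijective lie_antiaut_fun;
  lie_antiaut_bracket : forall u v,
    lie_antiaut_fun [lie u, v] = [lie lie_antiaut_fun v, lie_antiaut_fun u]
}.

Definition mat2 (T : Type) (a b c d : T) : 'M[T]_2 :=
  \matrix_(i, j) if i == 0 then (if j == 0 then a else b)
                 else (if j == 0 then c else d).

Lemma mat2P (T : Type) (x y : 'M[T]_2) :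
    x 0 0 = y 0 0 -> x 0 1 = y 0 1 -> x 1 0 = y 1 0 -> x 1 1 = y 1 1 -> x = y.
Proof.
move=> e00 e01 e10 e11; apply/matrixP => i j.
have ord2P (k : 'I_2) : k = 0 \/ k = 1.
  by case: k => [[|[|k]] ltk] //; [left|right]; apply: val_inj.
by case: (ord2P i) => ->; case: (ord2P j) => ->.
Qed.

Lemma mat2E (T : Type) (a b c d : T) :
  (mat2 a b c d 0 0 = a) * (mat2 a b c d 0 1 = b) *
  (mat2 a b c d 1 0 = c) * (mat2 a b c d 1 1 = d).
Proof. by rewrite !mxE. Qed.

Lemma mulmx2E (R : pzSemiRingType) (x y : 'M[R]_2) i j :
  (x *m y) i j = x i 0 * y 0 j + x i 1 * y 1 j.
Proof.
rewrite mxE !big_ord_recl big_ord0 addr0.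
by rewrite (_ : lift ord0 ord0 = 1) //; apply: val_inj.
Qed.

Lemma comm_mx2_linearl (R : comNzRingType) (a : R) (x y z : 'M[R]_2) :
  (a *: x + y) *m z - z *m (a *: x + y) =
  a *: (x *m z - z *m x) + (y *m z - z *m y).
Proof.
rewrite mulmxDl mulmxDr -scalemxAl -scalemxAr opprD scalerDr scalerN.
by rewrite addrACA.
Qed.

Lemma comm_mx2_jacobi (R : comNzRingType) (x y z : 'M[R]_2) :
  (x *m (y *m z - z *m y) - (y *m z - z *m y) *m x) +
  (y *m (z *m x - x *m z) - (z *m x - x *m z) *m y) +
  (z *m (x *m y - y *m x) - (x *m y - y *m x) *m z) = 0.
Proof.
have E (u v : 'M[R]_2) i j : (u + v) i j = u i j + v i j by rewrite mxE.
have N (u : 'M[R]_2) i j : (- u) i j = - u i j by rewrite mxE.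
have O i j : (0 : 'M[R]_2) i j = 0 by rewrite mxE.
by apply: mat2P; rewrite !(E, N, O, mulmx2E); ring.
Qed.

Section Mat2Bracket.
Variables (R : comNzRingType) (f : {rmorphism R -> R}) (t tV : R).
Hypothesis tK : t * tV = 1.
Implicit Types x y : 'M[R]_2.

Let cm x y := x *m y - y *m x.
Let cmE x y i j : cm x y i j =
  x i 0 * y 0 j + x i 1 * y 1 j - (y i 0 * x 0 j + y i 1 * x 1 j).
Proof. by rewrite mxE [X in _ + X]mxE !mulmx2E. Qed.

Lemma mat2_theta_comm x y :
  let h x := mat2 (f (x 1 1)) (f (x 1 0)) (f (x 0 1)) (f (x 0 0)) in
  h (x *m y - y *m x) = h x *m h y - h y *m h x.
Proof.
rewrite /= -!/(cm _ _).
apply: mat2P; rewrite !(mat2E, cmE) !(rmorphB, rmorphD, rmorphM) /=.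
all: by congr (_ - _); apply: addrC.
Qed.

Lemma mat2_dagger_comm x y :
  let h x := mat2 (f (x 0 0)) (f (x 1 0)) (f (x 0 1)) (f (x 1 1)) in
  h (x *m y - y *m x) = h y *m h x - h x *m h y.
Proof.
rewrite /= -!/(cm _ _).
apply: mat2P; rewrite !(mat2E, cmE) !(rmorphB, rmorphD, rmorphM) /=.
all: by congr (_ - _); congr (_ + _); apply: mulrC.
Qed.

Lemma mat2_sigma_comm x y :
  let h x := mat2 (x 1 1) (x 1 0 * t) (x 0 1 * tV) (x 0 0) in
  h (x *m y - y *m x) = h x *m h y - h y *m h x.
Proof.
have tE p q : p * t * (q * tV) = p * q by rewrite mulrACA tK mulr1.
have tE' p q : p * tV * (q * t) = p * q by rewrite mulrACA (mulrC tV) tK mulr1.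
rewrite /= -!/(cm _ _).
by apply: mat2P; rewrite !(mat2E, cmE) ?tE ?tE'; ring.
Qed.

Lemma mat2_trace_comm x y : cm x y 0 0 + cm x y 1 1 = 0.
Proof. by rewrite !cmE; ring. Qed.
End Mat2Bracket.

(* The matrix type is renamed because 'M[laurent F]_2 is canonically a module
   over laurent F, whereas L(gl_2) is regarded as a vector space over F. *)
Definition loop_gl2 (F : fieldType) : Type := 'M[laurent F]_2.

HB.instance Definition _ (F : fieldType) :=
  GRing.Zmodule.copy (loop_gl2 F) 'M[laurent F]_2.

Section LoopGl2.
Variable F : fieldType.
Implicit Types (x y z : loop_gl2 F) (c : F).

Local Notation t := (tvar F).
Local Notation tV := (tinv F).

Definition loop_scale c x : loop_gl2 F := map_mx (GRing.scale c) x.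

Fact loop_scaleA c d x :
  loop_scale c (loop_scale d x) = loop_scale (c * d) x.
Proof. by apply: mat2P; rewrite !mxE scalerA. Qed.

Fact loop_scale1 : left_id 1 loop_scale.
Proof. by move=> x; apply: mat2P; rewrite !mxE scale1r. Qed.

Fact loop_scaleDr : right_distributive loop_scale +%R.
Proof. by move=> c x y; apply: mat2P; rewrite !mxE scalerDr. Qed.

Fact loop_scaleDl x : {morph loop_scale^~ x : c d / c + d}.
Proof. by move=> c d; apply: mat2P; rewrite !mxE scalerDl. Qed.

HB.instance Definition _ := GRing.Zmodule_isLmodule.Build F (loop_gl2 F)
  loop_scaleA loop_scale1 loop_scaleDr loop_scaleDl.

Lemma loopDE x y i j : (x + y) i j = x i j + y i j. Proof. exact: mxE. Qed.
Lemma loopNE x i j : (- x) i j = - x i j. Proof. exact: mxE. Qed.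
Lemma loop0E i j : (0 : loop_gl2 F) i j = 0. Proof. exact: mxE. Qed.
Lemma loopZE c x i j : (c *: x) i j = c *: x i j. Proof. exact: mxE. Qed.
Definition loopE := (loopDE, loopNE, loop0E, loopZE).

Definition commutator x y : loop_gl2 F := x *m y - y *m x.

Fact commutatorxx x : commutator x x = 0.
Proof. exact: subrr. Qed.

Fact commutatorC x y : commutator x y = - commutator y x.
Proof. by rewrite /commutator opprB. Qed.

Lemma loop_scaleE c x : c *: x = (c%:A : laurent F) *: (x : 'M[laurent F]_2).
Proof. by apply: mat2P; rewrite !mxE mulr_algl. Qed.

Fact commutator_linearl y : linear (commutator^~ y).
Proof. by move=> c u v; rewrite !loop_scaleE; apply: comm_mx2_linearl. Qed.

Fact commutator_linearr x : linear (commutator x).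
Proof.
move=> c u v; rewrite !(commutatorC x) commutator_linearl.
by rewrite scalerN opprD.
Qed.

Fact commutator_jacobi x y z :
  commutator x (commutator y z) + commutator y (commutator z x)
  + commutator z (commutator x y) = 0.
Proof. exact: comm_mx2_jacobi. Qed.

HB.instance Definition _ := Lmodule_isLieAlgebra.Build F (loop_gl2 F)
  commutator_linearl commutator_linearr commutatorxx commutator_jacobi.

Definition theta x : loop_gl2 F :=
  mat2 (linv (x 1 1)) (linv (x 1 0))
       (linv (x 0 1)) (linv (x 0 0)).

Definition sigma x : loop_gl2 F :=
  mat2 (x 1 1)      (x 1 0 * t)
       (x 0 1 * tV) (x 0 0).

Definition dagger x : loop_gl2 F :=
  mat2 (linv (x 0 0)) (linv (x 1 0))
       (linv (x 0 1)) (linv (x 1 1)).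

Definition eps x : F := leval 1 (x 0 0) + leval 1 (x 1 1).

Lemma thetaE x :
  (theta x 0 0 = linv (x 1 1)) * (theta x 0 1 = linv (x 1 0)) *
  (theta x 1 0 = linv (x 0 1)) * (theta x 1 1 = linv (x 0 0)).
Proof. by rewrite !mat2E. Qed.

Lemma sigmaE x :
  (sigma x 0 0 = x 1 1) * (sigma x 0 1 = x 1 0 * t) *
  (sigma x 1 0 = x 0 1 * tV) * (sigma x 1 1 = x 0 0).
Proof. by rewrite !mat2E. Qed.

Lemma daggerE x :
  (dagger x 0 0 = linv (x 0 0)) * (dagger x 0 1 = linv (x 1 0)) *
  (dagger x 1 0 = linv (x 0 1)) * (dagger x 1 1 = linv (x 1 1)).
Proof. by rewrite !mat2E. Qed.

Lemma tvarKl p : p * t * tV = p. Proof. by rewrite -mulrA tvarK mulr1. Qed.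
Lemma tinvKl p : p * tV * t = p.
Proof. by rewrite -mulrA (mulrC tV) tvarK mulr1. Qed.

Lemma theta_linear : linear theta.
Proof. by move=> c u v; apply: mat2P; rewrite !(thetaE, loopE) linearP. Qed.

Lemma sigma_linear : linear sigma.
Proof.
by move=> c u v; apply: mat2P; rewrite !(sigmaE, loopE) ?mulrDl ?scalerAl.
Qed.

Lemma dagger_linear : linear dagger.
Proof. by move=> c u v; apply: mat2P; rewrite !(daggerE, loopE) linearP. Qed.

Lemma eps_linear : linear_for *%R eps.
Proof.
by move=> c u v; rewrite /eps !loopE !linearP /= mulrDr addrACA.
Qed.

Lemma thetaK : involutive theta.
Proof. by move=> x; apply: mat2P; rewrite !thetaE linvK. Qed.

Lemma sigmaK : involutive sigma.
Proof. by move=> x; apply: mat2P; rewrite !sigmaE ?tvarKl ?tinvKl. Qed.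

Lemma daggerK : involutive dagger.
Proof. by move=> x; apply: mat2P; rewrite !daggerE linvK. Qed.

Lemma theta_bracket x y : theta [lie x, y] = [lie theta x, theta y].
Proof. exact: mat2_theta_comm. Qed.

Lemma sigma_bracket x y : sigma [lie x, y] = [lie sigma x, sigma y].
Proof. by apply: mat2_sigma_comm; apply: tvarK. Qed.

Lemma dagger_bracket x y : dagger [lie x, y] = [lie dagger y, dagger x].
Proof. exact: mat2_dagger_comm. Qed.

Lemma eps_bracket x y : eps [lie x, y] = 0.
Proof.
by rewrite /eps -raddfD (_ : _ + _ = 0) ?raddf0 //; apply: mat2_trace_comm.
Qed.

Lemma theta_sigma x : theta (sigma x) = sigma (theta x).
Proof.
apply: mat2P; rewrite !(thetaE, sigmaE) ?linvM //.
- by rewrite linv_tinv.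
- by rewrite linv_tvar.
Qed.

Lemma theta_dagger x : theta (dagger x) = dagger (theta x).
Proof. by apply: mat2P; rewrite !(thetaE, daggerE). Qed.

Lemma sigma_dagger x : sigma (dagger x) = dagger (sigma x).
Proof.
apply: mat2P; rewrite !(daggerE, sigmaE) ?linvM //.
- by rewrite linv_tinv.
- by rewrite linv_tvar.
Qed.

Lemma eps_sigma x : eps (sigma x) = eps x.
Proof. by rewrite /eps !sigmaE addrC. Qed.

Lemma eps_dagger x : eps (dagger x) = eps x.
Proof. by rewrite /eps !daggerE !leval_linv. Qed.

End LoopGl2.

(* The ideal written as a calligraphic L, i.e. the kernel of eps. *)
Definition ker_eps (F : fieldType) : {pred loop_gl2 F} :=
  fun x => eps x == 0.

Definition O_pred (F : fieldType) : {pred loop_gl2 F} :=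
  fun x => (x \in @ker_eps F) && (theta x == x).

Lemma O_predP (F : fieldType) (x : loop_gl2 F) :
  reflect (eps x = 0 /\ theta x = x) (x \in @O_pred F).
Proof. by apply: (iffP andP) => -[/eqP ? /eqP ?]. Qed.

Fact O_submod_closed (F : fieldType) : submod_closed (@O_pred F).
Proof.
have eps0 : eps (0 : loop_gl2 F) = 0.
  by rewrite -[X in eps X](subrr 0) -scaleN1r addrC eps_linear mulN1r addNr.
have theta0 : theta (0 : loop_gl2 F) = 0.
  by rewrite -[X in theta X](subrr 0) -scaleN1r addrC theta_linear scaleN1r addNr.
split; first exact/O_predP.
move=> c u v /O_predP[eu tu] /O_predP[ev tv]; apply/O_predP.
by rewrite eps_linear theta_linear eu ev tu tv mulr0 addr0.
Qed.

HB.instance Definition _ (F : fieldType) :=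
  GRing.isSubmodClosed.Build F (loop_gl2 F) (@O_pred F)
    (@O_submod_closed F).

Record O_alg (F : fieldType) := OElt {
  O_val :> loop_gl2 F;
  O_valP : O_val \in @O_pred F
}.

HB.instance Definition _ (F : fieldType) := [isSub for @O_val F].
HB.instance Definition _ (F : fieldType) := [Choice of O_alg F by <:].
HB.instance Definition _ (F : fieldType) :=
  [SubChoice_isSubLmodule of O_alg F by <:].

Section OAlg.
Variable F : fieldType.
Implicit Types (u v w : O_alg F) (c : F) (k : nat).

Local Notation t := (tvar F).
Local Notation tV := (tinv F).

Fact O_bracket_subproof u v : [lie O_val u, O_val v] \in @O_pred F.
Proof.
apply/O_predP; split; first exact: eps_bracket.
have /O_predP[_ tu] := O_valP u; have /O_predP[_ tv] := O_valP v.
by rewrite theta_bracket tu tv.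
Qed.

Definition O_bracket u v : O_alg F := OElt (O_bracket_subproof u v).

Fact O_bracket_linearl v : linear (O_bracket^~ v).
Proof. by move=> c u w; apply: val_inj; apply: bracket_linearl. Qed.

Fact O_bracket_linearr u : linear (O_bracket u).
Proof. by move=> c v w; apply: val_inj; apply: bracket_linearr. Qed.

Fact O_bracketxx u : O_bracket u u = 0.
Proof. by apply: val_inj; rewrite /= bracketxx. Qed.

Fact O_bracket_jacobi u v w :
  O_bracket u (O_bracket v w) + O_bracket v (O_bracket w u)
  + O_bracket w (O_bracket u v) = 0.
Proof. by apply: val_inj; apply: bracket_jacobi. Qed.

HB.instance Definition _ := Lmodule_isLieAlgebra.Build F (O_alg F)
  O_bracket_linearl O_bracket_linearr O_bracketxx O_bracket_jacobi.

Fact O_sigma_subproof u : sigma u \in @O_pred F.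
Proof.
have /O_predP[eu tu] := O_valP u.
by apply/O_predP; rewrite eps_sigma theta_sigma eu tu.
Qed.

Fact O_dagger_subproof u : dagger u \in @O_pred F.
Proof.
have /O_predP[eu tu] := O_valP u.
by apply/O_predP; rewrite eps_dagger theta_dagger eu tu.
Qed.

Definition O_sigma_fun u : O_alg F := OElt (O_sigma_subproof u).
Definition O_dagger_fun u : O_alg F := OElt (O_dagger_subproof u).

Fact O_sigma_linear : linear O_sigma_fun.
Proof. by move=> c u v; apply: val_inj; apply: sigma_linear. Qed.

Fact O_sigma_bij : bijective O_sigma_fun.
Proof. by apply: inv_bij => u; apply: val_inj; apply: sigmaK. Qed.

Fact O_sigma_bracket u v :
  O_sigma_fun [lie u, v] = [lie O_sigma_fun u, O_sigma_fun v].
Proof. by apply: val_inj; apply: sigma_bracket. Qed.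

Definition O_sigma : lie_aut (O_alg F) :=
  LieAut O_sigma_linear O_sigma_bij O_sigma_bracket.

Fact O_dagger_linear : linear O_dagger_fun.
Proof. by move=> c u v; apply: val_inj; apply: dagger_linear. Qed.

Fact O_dagger_bij : bijective O_dagger_fun.
Proof. by apply: inv_bij => u; apply: val_inj; apply: daggerK. Qed.

Fact O_dagger_bracket u v :
  O_dagger_fun [lie u, v] = [lie O_dagger_fun v, O_dagger_fun u].
Proof. by apply: val_inj; apply: dagger_bracket. Qed.

Definition O_dagger : lie_antiaut (O_alg F) :=
  LieAntiaut O_dagger_linear O_dagger_bij O_dagger_bracket.

(* (t + t^-1) / 2 *)
Definition thalf : laurent F := 2%:R^-1 *: (t + tV).

Definition W_neg_mx k : loop_gl2 F := thalf ^+ k *: mat2 0 1 1 0.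
Definition W_pos_mx k : loop_gl2 F := thalf ^+ k *: mat2 0 t tV 0.
Definition G_mx k : loop_gl2 F :=
  thalf ^+ k *: mat2 (2%:R * t - 2%:R) 0 0 (2%:R * tV - 2%:R).
Definition Gt_mx k : loop_gl2 F :=
  thalf ^+ k *: mat2 (2%:R * tV - 2%:R) 0 0 (2%:R * t - 2%:R).

Lemma linv_thalfX k : linv (thalf ^+ k) = thalf ^+ k.
Proof.
rewrite rmorphXn /=; congr (_ ^+ _).
by rewrite linearZ /= linvD linv_tvar linv_tinv addrC.
Qed.

Lemma scale_mat2E (p a b c d : laurent F) :
  p *: mat2 a b c d = mat2 (p * a) (p * b) (p * c) (p * d).
Proof. by apply: mat2P; rewrite mxE !mat2E. Qed.

Lemma eps_mat2 (a b c d : laurent F) : eps (mat2 a b c d) = leval 1 (a + d).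
Proof. by rewrite /eps !mat2E -raddfD. Qed.

Lemma theta_mat2 (a b c d : laurent F) :
  theta (mat2 a b c d) = mat2 (linv d) (linv c) (linv b) (linv a).
Proof. by apply: mat2P; rewrite !mat2E. Qed.

Lemma linvB2t : linv (2%:R * t - 2%:R) = 2%:R * tV - 2%:R.
Proof. by rewrite raddfB /= linvM linv_tvar rmorph_nat. Qed.

Lemma linvB2tV : linv (2%:R * tV - 2%:R) = 2%:R * t - 2%:R.
Proof. by rewrite raddfB /= linvM linv_tinv rmorph_nat. Qed.

Lemma leval_B2t : leval 1 ((2%:R * t - 2%:R) + (2%:R * tV - 2%:R)) = 0.
Proof.
have lt1 : leval 1 t = 1 by rewrite levalU mul1r exp1rz.
have ltV1 : leval 1 tV = 1 by rewrite levalU mul1r exp1rz.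
have l1 : leval 1 (1 : laurent F) = 1 by rewrite -lmono1 levalU mul1r exp1rz.
have l2 : leval 1 (2%:R : laurent F) = 2%:R by rewrite raddfMn /= l1.
have levalB p q : leval 1 (p - q) = leval 1 p - leval 1 q by apply: raddfB.
by rewrite levalD !levalB !levalM ?oner_eq0 // lt1 ltV1 l2 mulr1 !subrr addr0.
Qed.

Fact W_neg_subproof k : W_neg_mx k \in @O_pred F.
Proof.
apply/O_predP; rewrite /W_neg_mx scale_mat2E eps_mat2 theta_mat2.
rewrite mulr0 addr0 mulr1 !linv_thalfX.
by split; [exact: raddf0 | rewrite raddf0].
Qed.

Fact W_pos_subproof k : W_pos_mx k \in @O_pred F.
Proof.
apply/O_predP; rewrite /W_pos_mx scale_mat2E eps_mat2 theta_mat2.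
rewrite mulr0 addr0 !linvM linv_tvar linv_tinv !linv_thalfX.
by split; [exact: raddf0 | rewrite raddf0].
Qed.

Fact G_subproof k : G_mx k \in @O_pred F.
Proof.
apply/O_predP; rewrite /G_mx scale_mat2E eps_mat2 theta_mat2.
rewrite -mulrDr levalM ?oner_eq0 // leval_B2t !mulr0 !linvM raddf0.
by rewrite linvB2t linvB2tV !linv_thalfX.
Qed.

Fact Gt_subproof k : Gt_mx k \in @O_pred F.
Proof.
apply/O_predP; rewrite /Gt_mx scale_mat2E eps_mat2 theta_mat2.
rewrite -mulrDr addrC levalM ?oner_eq0 // leval_B2t !mulr0 !linvM raddf0.
by rewrite linvB2t linvB2tV !linv_thalfX.
Qed.

(* W_neg k, W_pos k, G k, Gt k are indexed from k = 0 and denote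
   W_{-k}, W_{k+1}, G_{k+1} and G~_{k+1} respectively. *)
Definition W_neg k : O_alg F := OElt (W_neg_subproof k).
Definition W_pos k : O_alg F := OElt (W_pos_subproof k).
Definition G k : O_alg F := OElt (G_subproof k).
Definition Gt k : O_alg F := OElt (Gt_subproof k).
End OAlg.

(* Main.v *)
Require Import Defs.
From mathcomp Require Import all_boot all_order all_algebra.
Import GRing.Theory.
Local Open Scope ring_scope.

(** Each of the eight elements is a scalar Laurent polynomial
    [p = ((t + t^-1)/2)^k] times a matrix [m] that does not depend on [k].
    Since [sigma] does not touch the scalar ([sigma_scale]), and [dagger] only
    inverts [t] in it, which leaves [p] unchanged ([dagger_scale]), both maps
    act on the factor [m] alone.  There the claims are read off entrywise:
    [sigma] exchanges the diagonal entries, and exchanges the antidiagonal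
    pairs (1, 1) and (t, t^-1); [dagger] fixes both antidiagonal pairs, because
    transposition and [t |-> t^-1] undo each other on (t, t^-1), and it
    exchanges [2t - 2] with [2t^-1 - 2] on the diagonal. *)

Lemma sigma_mat2 (F : fieldType) (a b c d : laurent F) :
  sigma (mat2 a b c d) = mat2 d (c * tvar F) (b * tinv F) a.
Proof. by apply: mat2P; rewrite !mat2E. Qed.

Lemma dagger_mat2 (F : fieldType) (a b c d : laurent F) :
  dagger (mat2 a b c d) = mat2 (linv a) (linv c) (linv b) (linv d).
Proof. by apply: mat2P; rewrite !mat2E. Qed.

Lemma sigma_scale (F : fieldType) (p : laurent F) (m : 'M[laurent F]_2) :
  sigma (p *: m) = p *: (sigma m : 'M[laurent F]_2).
Proof. by apply: mat2P; rewrite !mxE /= ?mulrA. Qed.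

(** [dagger] is only semilinear over Laurent polynomials, with respect to
    [t |-> t^-1]; hence the invariance hypothesis on the scalar. *)
Lemma dagger_scale (F : fieldType) (p : laurent F) (m : 'M[laurent F]_2) :
  linv p = p -> dagger (p *: m) = p *: (dagger m : 'M[laurent F]_2).
Proof. by move=> pV; apply: mat2P; rewrite !mxE /= linvM pV. Qed.

Theorem lemma4p15 (F : fieldType) (charF : [pchar F] =i pred0) (k : nat) :
  (O_sigma F (W_neg F k) = W_pos F k /\
   O_sigma F (W_pos F k) = W_neg F k /\
   O_sigma F (Gt F k) = G F k /\
   O_sigma F (G F k) = Gt F k) /\
  (O_dagger F (W_neg F k) = W_neg F k /\
   O_dagger F (W_pos F k) = W_pos F k /\
   O_dagger F (Gt F k) = G F k /\
   O_dagger F (G F k) = Gt F k).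
Proof.
have tVt : tinv F * tvar F = 1 by rewrite mulrC tvarK.
have linv0 : linv (0 : laurent F) = 0 by rewrite raddf0.
have linv1 : linv (1 : laurent F) = 1 by rewrite rmorph1.
have pV := linv_thalfX F k.
split; do 3?split; apply: val_inj => /=;
  rewrite /W_neg_mx /W_pos_mx /G_mx /Gt_mx.
- by rewrite sigma_scale sigma_mat2 !mul1r.
- by rewrite sigma_scale sigma_mat2 tvarK tVt.
- by rewrite sigma_scale sigma_mat2 !mul0r.
- by rewrite sigma_scale sigma_mat2 !mul0r.
- by rewrite (dagger_scale _ _ _ pV) dagger_mat2 linv0 linv1.
- by rewrite (dagger_scale _ _ _ pV) dagger_mat2 linv0 linv_tvar linv_tinv.
- by rewrite (dagger_scale _ _ _ pV) dagger_mat2 linv0 linvB2t linvB2tV.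
- by rewrite (dagger_scale _ _ _ pV) dagger_mat2 linv0 linvB2t linvB2tV.
Qed.
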